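(* Let $X(\boldsymbol{s})$ be a statistically isotropic ($R^\ast=1$), stationary, mean-square differentiable Gaussian random field on $\mathcal{D}\subset\mathbb{R}^2$ sampled at $N$ points. Assume that the covariance $c(\boldsymbol{r})$ is short-ranged, that its spectral density satisfies $\tilde{C}(\boldsymbol{k})=\mathcal{O}(\|\boldsymbol{k}\|^{-3-\epsilon})$ for some $\epsilon>0$ as $\|\boldsymbol{k}\|\to\infty$, and that the asymptotic regime conditions hold. Let $p\in[0,1)$ and $\ell_p=-2\ln(1-p)$, i.e. the inverse at $p$ of the chi-square cumulative distribution function with two degrees of freedom, and suppose $N>2\ell_p$. Then the (non-parametric) probability region at level $p$ does not depend on $\theta$ and reduces to the following probability interval of the anisotropic ratio $R$: $$ \left(\sqrt{\frac{N-2\sqrt{\ell_p(N-\ell_p)}}{N-2\ell_p}}\;,\;\sqrt{\frac{N+2\sqrt{\ell_p(N-\ell_p)}}{N-2\ell_p}}\right). $$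
   Context: Setting. $X(\boldsymbol{s})$ is a wide-sense stationary Gaussian random field with constant mean and covariance function $c(\boldsymbol{r})$, first-order differentiable in the mean-square sense. Short-ranged means $\int d\boldsymbol{r}\,|c(\boldsymbol{r})|<\infty$; $\tilde{C}$ is the Fourier transform of $c$, and the decay condition means $\tilde C(\boldsymbol{k})\le C_\infty/\|\boldsymbol{k}\|^{3+\epsilon}$ for some $\epsilon,C_\infty>0$ and all large $\|\boldsymbol{k}\|$. The anisotropy parameters are $R^\ast$ (ratio $\xi_2/\xi_1$ of principal correlation lengths) and $\theta^\ast$ (orientation angle); isotropy is $R^\ast=1$. The asymptotic regime is $N\to\infty$ and $|\mathcal D|\to\infty$ with both ratios of domain length to correlation length tending to infinity. Non-parametric probability region. For values $R\ge0$ and $\theta$, parameters $R^\ast,\theta^\ast$, and $\delta\theta=\theta-\theta^\ast$, put $$ y_0=\frac{1}{\sqrt{2}\,z_{1;0}}\Big[(R^2-1)(R^{\ast2}-1)\cos(2\delta\theta)-(R^2+1)(R^{\ast2}+1)\Big], $$ with $z_{1;0}>0$ and $$ z_{1;0}^2=(R^2-1)^2(R^{\ast2}-1)^2\cos(4\delta\theta)-4(R^4-1)(R^{\ast4}-1)\cos(2\delta\theta)+(R^4+1)(3R^{\ast4}+2R^{\ast2}+3)+2R^2(R^{\ast2}-1)^2 . $$ The non-parametric probability region of the anisotropy statistics $(\hat R,\hat\theta)$ at level $p$ is the set of $(R,\theta)$ enclosed by the curve $$ y_0^2(R,\theta;R^\ast,\theta^\ast)-\frac12=\frac{\ln(1-p)}{N},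 $$ that is, the set of $(R,\theta)$ with $R\ge 0$ and $y_0^2-\frac12>\frac{\ln(1-p)}{N}$. *)

(* Defs.v *)
From mathcomp Require Export all_boot all_order all_algebra.
From mathcomp Require Export all_classical all_reals all_analysis.
From mathcomp Require Import complex.
Export Order.TTheory GRing.Theory Num.Theory numFieldNormedType.Exports.

Set Implicit Arguments.
Unset Strict Implicit.
Unset Printing Implicit Defensive.

Local Open Scope classical_set_scope.
Local Open Scope ring_scope.

(* The plane is [R * R], whose library norm is the
   sup norm; Euclidean lengths go through [eucl]. *)

Section Plane.
Context {R : realType}.

Definition eucl (r : R * R) : R := Num.sqrt (r.1 ^+ 2 + r.2 ^+ 2).

Definition area : set (R * R) -> \bar R :=
  (@lebesgue_measure R \x @lebesgue_measure R)%E.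

Definition principal (theta : R) (r : R * R) : R * R :=
  (cos theta * r.1 + sin theta * r.2, - sin theta * r.1 + cos theta * r.2).

(* Elliptical anisotropy: the level sets of [c] are ellipses with principal
   axes in the directions [theta] and [theta + pi / 2], in the proportion
   [xi1 : xi2].  When [xi1 = xi2] this says that [c] is a function of the
   Euclidean norm. *)
Definition elliptical_covariance (c : R * R -> R) (xi1 xi2 theta : R) : Prop :=
  exists rho : R -> R, forall r,
    c r = rho (Num.sqrt (((principal theta r).1 / xi1) ^+ 2
                       + ((principal theta r).2 / xi2) ^+ 2)).

Definition short_ranged (c : R * R -> R) : Prop :=
  (@lebesgue_measure R \x @lebesgue_measure R)%E.-integrable setT (EFin \o c).

(* The Fourier transform of [c], with kernel [exp (- i k.r)]. *)
Definition spectral_density (c : R * R -> R) (k : R * R) : R[i] :=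
  ((\int[(@lebesgue_measure R \x @lebesgue_measure R)%E]_r
       (c r * cos (k.1 * r.1 + k.2 * r.2)))
   +i* (- \int[(@lebesgue_measure R \x @lebesgue_measure R)%E]_r
       (c r * sin (k.1 * r.1 + k.2 * r.2))))%C.

Definition spectral_decay (c : R * R -> R) : Prop :=
  exists eps Cinf K : R, [/\ 0 < eps, 0 < Cinf, 0 < K &
    forall k : R * R, K <= eucl k ->
      ComplexField.Normc.normc (spectral_density c k)
        <= Cinf / eucl k `^ (3 + eps)].

End Plane.

(* A random field on [D] is a family of random variables indexed by the plane,
   of which only the members [X s] with [D s] are constrained. *)
Section RandomField.
Context {R : realType} {d : measure_display} {T : measurableType d}
  (P : probability T R).

Definition wide_sense_stationary (D : set (R * R))
    (X : R * R -> {RV P >-> R}) (m : R) (c : R * R -> R) : Prop :=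
  [/\ forall s, D s -> (X s : T -> R) \in Lfun P 2%:E,
      forall s, D s -> ('E_P[X s] = m%:E)%E &
      forall s s', D s -> D s' -> covariance P (X s) (X s') = (c (s' - s))%:E].

(* The library's [normal_prob m 0] is not the point mass at [m]; a Gaussian
   variable of variance 0 is constant. *)
Definition gaussian_law (Y : T -> R) : Prop :=
  exists m sigma : R, 0 <= sigma /\
    forall A : set (measurableTypeR R), measurable A ->
      P (Y @^-1` A) = if sigma == 0 then \d_m A else normal_prob m sigma A.

Definition gaussian_field (D : set (R * R)) (X : R * R -> {RV P >-> R}) : Prop :=
  forall (n : nat) (s : 'I_n -> R * R) (a : 'I_n -> R),
    (forall i, D (s i)) ->
    gaussian_law (fun w => \sum_(i < n) a i * X (s i) w).

Definition has_ms_derivative (D : set (R * R)) (X : R * R -> {RV P >-> R})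
    (s e : R * R) (Y : T -> R) : Prop :=
  ('E_P[fun w : T =>
      (((X (s.1 + h * e.1, s.2 + h * e.2) w - X s w) / h - Y w) ^+ 2)%R])%E
    @[h --> within [set h | D (s.1 + h * e.1, s.2 + h * e.2)] 0^'] --> 0%E.

Definition ms_differentiable (D : set (R * R)) (X : R * R -> {RV P >-> R}) : Prop :=
  forall s, D s -> exists Y1 Y2 : {RV P >-> R},
    [/\ (Y1 : T -> R) \in Lfun P 2%:E, (Y2 : T -> R) \in Lfun P 2%:E,
        has_ms_derivative D X s (1, 0) Y1 &
        has_ms_derivative D X s (0, 1) Y2].

End RandomField.

Section Sampling.
Context {R : realType}.

(* [domain_length f D] is the length of the projection of [D] along the linear
   coordinate [f]. *)
Definition domain_length (f : R * R -> R) (D : set (R * R)) : \bar R :=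
  ereal_sup [set x | exists s s', [/\ D s, D s' & x = `|f (s' - s)|%:E]].

(* Sampling scheme number [n] consists of [N n] distinct points of [D n]. *)
Definition asymptotic_regime (D : nat -> set (R * R)) (N : nat -> nat)
    (xi1 xi2 theta : R) : Prop :=
  [/\ ((N n)%:R : R) @[n --> \oo] --> +oo%R,
      area (D n) @[n --> \oo] --> +oo%E,
      (domain_length (fun r => (principal theta r).1) (D n)
         * (xi1^-1)%:E)%E @[n --> \oo] --> +oo%E &
      (domain_length (fun r => (principal theta r).2) (D n)
         * (xi2^-1)%:E)%E @[n --> \oo] --> +oo%E].

End Sampling.

Section ProbabilityRegion.
Context {R : realType}.
Implicit Types r theta rstar thetastar : R.

Definition z10 r theta rstar thetastar : R :=
  let dtheta := theta - thetastar in
  Num.sqrt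
    ((r ^+ 2 - 1) ^+ 2 * (rstar ^+ 2 - 1) ^+ 2 * cos (4 * dtheta)
     - 4 * (r ^+ 4 - 1) * (rstar ^+ 4 - 1) * cos (2 * dtheta)
     + (r ^+ 4 + 1) * (3 * rstar ^+ 4 + 2 * rstar ^+ 2 + 3)
     + 2 * r ^+ 2 * (rstar ^+ 2 - 1) ^+ 2).

Definition y0 r theta rstar thetastar : R :=
  let dtheta := theta - thetastar in
  (Num.sqrt 2 * z10 r theta rstar thetastar)^-1
  * ((r ^+ 2 - 1) * (rstar ^+ 2 - 1) * cos (2 * dtheta)
     - (r ^+ 2 + 1) * (rstar ^+ 2 + 1)).

Definition probability_region (N : nat) (p rstar thetastar : R) : set (R * R) :=
  [set q | 0 <= q.1 /\
     ln (1 - p) / N%:R < y0 q.1 q.2 rstar thetastar ^+ 2 - 1 / 2].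

End ProbabilityRegion.

Section ChiSquare.
Context {R : realType}.

Definition gamma_fun (a : R) : R :=
  \int[@lebesgue_measure R]_(t in `]0, +oo[) (t `^ (a - 1) * expR (- t)).

Definition chi2_pdf (k : nat) (x : R) : R :=
  x `^ (k%:R / 2 - 1) * expR (- x / 2) / (2 `^ (k%:R / 2) * gamma_fun (k%:R / 2)).

Definition chi2_cdf (k : nat) (x : R) : R :=
  \int[@lebesgue_measure R]_(t in `]0, x]) chi2_pdf k t.

Definition chi2_inverse_at (k : nat) (p q : R) : Prop :=
  0 <= q /\ forall x, 0 <= x -> (chi2_cdf k x = p <-> x = q).

End ChiSquare.

(* Main.v *)
Require Import Defs.
From mathcomp Require Import all_boot all_order all_algebra.
From mathcomp Require Import all_classical all_reals all_analysis.
From mathcomp Require Import measurable_realfun ring lra.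

(** The probability region is given by an explicit inequality, so the theorem
is a computation in two independent parts.

The chi-square law with two degrees of freedom is the exponential law of rate
[1 / 2]: its density at [t > 0] is [expR (- t / 2) / (2 * Gamma 1)], and
[Gamma 1 = 1] because it is the total mass of the exponential law of rate 1.
Its cumulative distribution function is therefore [1 - expR (- x / 2)]
([chi2_cdf2]), which takes the value [p] exactly at [- 2 * ln (1 - p)].

When [rstar = 1] every cosine in [y0] and [z10] carries a vanishing factor
[rstar ^+ k - 1], so the angle disappears and
[y0 ^+ 2 - 1 / 2 = - (r ^+ 2 - 1) ^+ 2 / (4 * (r ^+ 4 + 1))] ([y0_isotropic]).
As [ln (1 - p) = - l / 2], the region becomes
[n * (r ^+ 2 - 1) ^+ 2 < 2 * l * (r ^+ 4 + 1)], a quadratic inequality in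
[u = r ^+ 2],
  [(n - 2 * l) * u ^+ 2 - 2 * n * u + (n - 2 * l) < 0].
The condition [2 * l < n] makes its leading coefficient positive, so the
solutions lie strictly between the two roots
[(n -/+ 2 * sqrt (l * (n - l))) / (n - 2 * l)]. These are positive (their
product is 1 and the larger one is positive), and taking square roots gives the interval
([isotropic_quadratic_interval]). *)

Local Open Scope classical_set_scope.
Local Open Scope ring_scope.

Lemma Rintegral_exponential_pdf_itvoc (R : realType) (rate x : R) :
  0 <= x ->
  \int[@lebesgue_measure R]_(t in `]0, x]) exponential_pdf rate t
    = 1 - expR (- rate * x).
Proof.
rewrite le_eqVlt => /predU1P[<-|x0].
  by rewrite set_itvoc0 Rintegral_set0 mulr0 expR0 subrr.
rewrite /Rintegral integral_itv_obnd_cbnd; last first.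
  apply/measurable_EFinP/measurable_funTS; exact: measurable_exponential_pdf.
by have := exponential_prob_itv0c rate x0; rewrite /exponential_prob => ->.
Qed.

(** The integrand of [Gamma 1] is the density of the exponential law of rate 1,
whose total mass is 1. *)
Lemma gamma_fun1 (R : realType) : gamma_fun 1 = 1 :> R.
Proof.
transitivity (\int[@lebesgue_measure R]_(t in `]0, +oo[) exponential_pdf 1 t).
  apply: eq_Rintegral => t; rewrite inE/= in_itv/= andbT => t0.
  by rewrite exponential_pdfE ?ltW// subrr powRr0 !mul1r mulN1r.
rewrite /Rintegral integral_itv_obnd_cbnd; last first.
  apply/measurable_EFinP/measurable_funTS; exact: measurable_exponential_pdf.
rewrite -[RHS]/(fine 1%E) -(@integral_exponential_pdf R 1 ltr01).
rewrite integral_mkcond; congr fine; apply: eq_integral => t _.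
rewrite restrict_EFin/= [in LHS]patchE; case: ifPn => // /negbTE t0.
by rewrite /exponential_pdf patchE t0.
Qed.

(** Two degrees of freedom make the exponent [k / 2 - 1] of the power factor
vanish, leaving the exponential density of rate [1 / 2]. *)
Lemma chi2_cdf2 (R : realType) (x : R) :
  0 <= x -> chi2_cdf 2 x = 1 - expR (- 2^-1 * x).
Proof.
move=> x0; rewrite -Rintegral_exponential_pdf_itvoc //.
apply: eq_Rintegral => t; rewrite inE/= in_itv/= => /andP[t0 _].
rewrite exponential_pdfE ?ltW// /chi2_pdf divff// subrr powRr0 mul1r.
by rewrite gamma_fun1 mulr1 powRr1// mulrC mulNr mulNr [t / 2]mulrC.
Qed.

Lemma chi2_inverse_at2 (R : realType) (p : R) :
  0 <= p -> p < 1 -> chi2_inverse_at 2 p (- 2 * ln (1 - p)).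
Proof.
move=> p0 p1; split.
  by rewrite mulNr oppr_ge0 pmulr_rle0// ln_le0// gerBl.
move=> x x0; rewrite chi2_cdf2//; split=> [<-|->].
  by rewrite subKr expRK mulrA mulrNN divff// mul1r.
by rewrite mulrA mulrNN mulVf// mul1r lnK ?subKr// posrE subr_gt0.
Qed.

(** The factors [rstar ^+ k - 1] kill the cosines, leaving
[z10 ^+ 2 = 8 * (r ^+ 4 + 1)] and the numerator [- 2 * (r ^+ 2 + 1)] of [y0];
then [(r ^+ 2 + 1) ^+ 2 - 2 * (r ^+ 4 + 1) = - (r ^+ 2 - 1) ^+ 2]. *)
Lemma y0_isotropic (R : realType) (r theta thetastar : R) :
  y0 r theta 1 thetastar ^+ 2 - 1 / 2
    = - (r ^+ 2 - 1) ^+ 2 / (4 * (r ^+ 4 + 1)).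
Proof.
have r4 : 0 < r ^+ 4 + 1 by rewrite ltr_wpDl// exprn_even_ge0.
rewrite /y0 /z10 exprMn exprVn exprMn sqr_sqrtr//.
rewrite sqr_sqrtr !expr1n !subrr; last first.
  by rewrite !mulr0 !mul0r; lra.
by field; rewrite gt_eqF.
Qed.

Lemma lt_sqrt_sqr (R : rcfType) (a r : R) :
  0 <= a -> 0 <= r -> (Num.sqrt a < r) = (a < r ^+ 2).
Proof.
by move=> a0 r0; rewrite -(@ltr_pXn2r _ 2)// ?nnegrE ?sqrtr_ge0// sqr_sqrtr.
Qed.

Lemma gt_sqrt_sqr (R : rcfType) (a r : R) :
  0 <= a -> 0 <= r -> (r < Num.sqrt a) = (r ^+ 2 < a).
Proof.
by move=> a0 r0; rewrite -(@ltr_pXn2r _ 2)// ?nnegrE ?sqrtr_ge0// sqr_sqrtr.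
Qed.

(** With [a = n - 2 * l] and [u = r ^+ 2], the right side minus the left side,
multiplied by [a > 0], is [4 * s ^+ 2 - (u * a - n) ^+ 2]. So the inequality
says [`|u * a - n| < 2 * s], that is, [u] lies between [(n - 2 * s) / a] and
[(n + 2 * s) / a]. *)
Lemma isotropic_quadratic_interval (R : rcfType) (n l r : R) :
    0 <= l -> 2 * l < n -> 0 <= r ->
  let s := Num.sqrt (l * (n - l)) in
  (n * (r ^+ 2 - 1) ^+ 2 < 2 * l * (r ^+ 4 + 1)) =
  (Num.sqrt ((n - 2 * s) / (n - 2 * l)) < r) &&
  (r < Num.sqrt ((n + 2 * s) / (n - 2 * l))).
Proof.
move=> l0 lt_l_n r0 s.
have a0 : 0 < n - 2 * l by lra.
have s0 : 0 <= s by exact: sqrtr_ge0.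
have s2 : s ^+ 2 = l * (n - l) by rewrite sqr_sqrtr// mulr_ge0//; lra.
(* [n ^+ 2 - (2 * s) ^+ 2 = (n - 2 * l) ^+ 2], so the smaller root is >= 0. *)
have sn : 2 * s <= n.
  rewrite -(@ler_pXn2r _ 2)// ?nnegrE ?mulr_ge0//; last lra.
  by rewrite exprMn s2 -subr_ge0; have := sqr_ge0 (n - 2 * l); lra.
have lo0 : 0 <= (n - 2 * s) / (n - 2 * l) by rewrite divr_ge0//; lra.
have hi0 : 0 <= (n + 2 * s) / (n - 2 * l) by rewrite divr_ge0//; lra.
rewrite lt_sqrt_sqr// gt_sqrt_sqr//.
rewrite ltr_pdivrMr// ltr_pdivlMr//.
have -> : (n - 2 * s < r ^+ 2 * (n - 2 * l)) && (r ^+ 2 * (n - 2 * l) < n + 2 * s)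
    = (`|r ^+ 2 * (n - 2 * l) - n| < 2 * s).
  by rewrite ltr_norml; congr (_ && _); apply/idP/idP; lra.
rewrite -[RHS](@ltr_pXn2r _ 2)// ?nnegrE ?mulr_ge0// real_normK ?num_real//.
rewrite -[LHS]subr_gt0 -[LHS](pmulr_rgt0 _ a0) -[RHS]subr_gt0 exprMn s2.
by congr (0 < _); ring.
Qed.

Theorem theorem5 (R : realType) (d : measure_display) (T : measurableType d)
    (P : probability T R)
    (* sampling domains, sample sizes and sampling points *)
    (D : nat -> set (R * R)) (N : nat -> nat)
    (pt : forall n : nat, 'I_(N n) -> R * R)
    (* field, mean, covariance function and anisotropy parameters *)
    (X : R * R -> {RV P >-> R}) (m : R) (c : R * R -> R)
    (xi1 xi2 rstar thetastar : R)
    (hD : forall n, measurable (D n))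
    (hpt : forall n, injective (pt n) /\ forall i, D n (pt n i))
    (hstat : wide_sense_stationary (\bigcup_n D n) X m c)
    (hgauss : gaussian_field (\bigcup_n D n) X)
    (hdiff : ms_differentiable (\bigcup_n D n) X)
    (hxi1 : 0 < xi1) (hxi2 : 0 < xi2)
    (haniso : elliptical_covariance c xi1 xi2 thetastar)
    (hrstar : rstar = xi2 / xi1)
    (hiso : rstar = 1)
    (hshort : short_ranged c)
    (hdecay : spectral_decay c)
    (hasym : asymptotic_regime D N xi1 xi2 thetastar)
    (p : R) (hp0 : 0 <= p) (hp1 : p < 1) :
  let l := - 2 * ln (1 - p) in
  chi2_inverse_at 2 p l /\
  forall n : nat, 2 * l < (N n)%:R ->
    probability_region (N n) p rstar thetastar =
    [set q : R * R |
      Num.sqrt (((N n)%:R - 2 * Num.sqrt (l * ((N n)%:R - l)))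
                / ((N n)%:R - 2 * l)) < q.1 /\
      q.1 < Num.sqrt (((N n)%:R + 2 * Num.sqrt (l * ((N n)%:R - l)))
                / ((N n)%:R - 2 * l))].
Proof.
move=> l; split; first exact: chi2_inverse_at2.
move=> n lN; have [l0 _] := chi2_inverse_at2 _ _ hp0 hp1.
rewrite -/l in l0.
have n0 : 0 < (N n)%:R :> R by lra.
apply/seteqP.
have key (q : R * R) : 0 <= q.1 ->
  (ln (1 - p) / (N n)%:R < y0 q.1 q.2 rstar thetastar ^+ 2 - 1 / 2) =
  ((N n)%:R * (q.1 ^+ 2 - 1) ^+ 2 < 2 * l * (q.1 ^+ 4 + 1)).
  move=> q0; rewrite hiso y0_isotropic ltr_pdivrMr// mulrAC.
  have r4 : 0 < 4 * (q.1 ^+ 4 + 1) by rewrite mulr_gt0// ltr_wpDl// exprn_even_ge0.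
  rewrite ltr_pdivlMr// -ltrN2; congr (_ < _); rewrite /l; ring.
split=> q /=.
  by move=> [q0]; rewrite key// isotropic_quadratic_interval// => /andP[].
move=> [q1 q2]; have q0 : 0 <= q.1 by exact: le_trans (sqrtr_ge0 _) (ltW q1).
by split=> //; rewrite key// isotropic_quadratic_interval// q1.
Qed.
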